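(* Let $c>1$ be a constant, and let $L,\mu_1,\mu_2>0$ with $\kappa_1=L/\mu_1\ge c$ and $\kappa_2=L/\mu_2\ge c$. Then for every step size ratio $r>0$ there exists a function $f\in\mathcal{F}(L,\mu_1,\mu_2)$ with a unique saddle point $z^*$ for which simGDA with any step sizes $(\alpha,\beta)=(\beta/r,\beta)$, $\beta>0$, requires at least $$K=\begin{cases}\Omega\left(\kappa_1r\log(1/\varepsilon)\right), & \text{if } r\ge\kappa_2/c,\\ \Omega\left(\kappa_1\kappa_2\log(1/\varepsilon)\right), & \text{if } c/\kappa_1\le r\le\kappa_2/c,\\ \Omega\left((\kappa_2/r)\log(1/\varepsilon)\right), & \text{if } 0<r\le c/\kappa_1\end{cases}$$ iterations to achieve either $\|z_K-z^*\|^2\le\varepsilon^2$ or $V_\lambda(z_K)\le\varepsilon^2$.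
   Context: $\mathcal{F}(L,\mu_1,\mu_2)$ is the class of functions $f(x;y)$ of two arguments $x\in\mathbb{R}^{d_x}$, $y\in\mathbb{R}^{d_y}$ (of any dimensions) that are $L$-smooth (differentiable with $L$-Lipschitz gradient), $\mu_1$-strongly convex in $x$ and $\mu_2$-strongly concave in $y$. A saddle point is $z^*=(x^*;y^* )$ with $f(x^*;y)\le f(x^*;y^* )\le f(x;y^* )$ for all $x,y$. simGDA (full-batch simultaneous gradient descent-ascent) with step sizes $\alpha,\beta$: $x_k=x_{k-1}-\alpha\nabla_1f(x_{k-1};y_{k-1})$, $y_k=y_{k-1}+\beta\nabla_2f(x_{k-1};y_{k-1})$, with $z_k=(x_k;y_k)$. $V_\lambda(x;y)=\lambda(\Phi(x)-\Phi^* )+(\Phi(x)-f(x;y))$, where $\lambda>0$ is a constant, $\Phi(x)=\max_{y'}f(x;y')$ and $\Phi^*=\min_x\Phi(x)$. Meaning of the lower bound: $\Omega$ hides a positive constant depending only on $c$. The bound is worst-case over the initial point and asymptotic in $\varepsilon$. That is, there is an initial point $z_0$ such that for all sufficiently small $\varepsilon>0$ (threshold not depending on $\beta$), for every $\beta>0$, any $K$ for which $z_K$ satisfies one of the two accuracy criteria is at least the displayed quantity. *)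

(* Defs.v *)
From mathcomp Require Import all_boot all_order all_algebra.
From mathcomp Require Export all_classical all_reals all_analysis.

Set Implicit Arguments.
Unset Strict Implicit.
Unset Printing Implicit Defensive.

Import Order.TTheory GRing.Theory Num.Theory numFieldNormedType.Exports.

Local Open Scope classical_set_scope.
Local Open Scope ring_scope.

(* The library's norm on row vectors and on pairs is the sup norm, so the
   Euclidean norm is introduced by hand. *)
Definition sqnorm (R : realType) (n : nat) (v : 'rV[R]_n) : R :=
  \sum_(i < n) v 0 i ^+ 2.

Definition sqnorm2 (R : realType) (m n : nat) (z : 'rV[R]_m * 'rV[R]_n) : R :=
  sqnorm z.1 + sqnorm z.2.

Definition norm2 (R : realType) (m n : nat) (z : 'rV[R]_m * 'rV[R]_n) : R :=
  Num.sqrt (sqnorm2 z).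

Definition grad (R : realType) (n : nat) (g : 'rV[R]_n -> R) (x : 'rV[R]_n) :
    'rV[R]_n :=
  \row_i 'D_(delta_mx 0 i) g x.

Definition grad1 (R : realType) (m n : nat) (f : 'rV[R]_m -> 'rV[R]_n -> R)
    (z : 'rV[R]_m * 'rV[R]_n) : 'rV[R]_m :=
  grad (fun x => f x z.2) z.1.

Definition grad2 (R : realType) (m n : nat) (f : 'rV[R]_m -> 'rV[R]_n -> R)
    (z : 'rV[R]_m * 'rV[R]_n) : 'rV[R]_n :=
  grad (fun y => f z.1 y) z.2.

(* Joint smoothness: Frechet differentiable in (x; y), and the full gradient
   (grad1 f; grad2 f) is L-Lipschitz for the Euclidean norm. *)
Definition smooth (R : realType) (m n : nat) (L : R)
    (f : 'rV[R]_m -> 'rV[R]_n -> R) : Prop :=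
  (forall z : 'rV[R]_m * 'rV[R]_n,
     differentiable (fun w : 'rV[R]_m * 'rV[R]_n => f w.1 w.2) z) /\
  (forall z w : 'rV[R]_m * 'rV[R]_n,
     norm2 (grad1 f z - grad1 f w, grad2 f z - grad2 f w)
     <= L * norm2 (z - w)).

Definition strongly_convex (R : realType) (n : nat) (mu : R)
    (g : 'rV[R]_n -> R) : Prop :=
  forall (x y : 'rV[R]_n) (t : R), 0 <= t <= 1 ->
    g (t *: x + (1 - t) *: y)
    <= t * g x + (1 - t) * g y - mu / 2 * t * (1 - t) * sqnorm (x - y).

Definition strongly_concave (R : realType) (n : nat) (mu : R)
    (g : 'rV[R]_n -> R) : Prop :=
  strongly_convex mu (fun y => - g y).

Definition classF (R : realType) (m n : nat) (L mu1 mu2 : R)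
    (f : 'rV[R]_m -> 'rV[R]_n -> R) : Prop :=
  [/\ smooth L f,
      forall y : 'rV[R]_n, strongly_convex mu1 (fun x => f x y) &
      forall x : 'rV[R]_m, strongly_concave mu2 (fun y => f x y)].

Definition saddle_point (R : realType) (m n : nat)
    (f : 'rV[R]_m -> 'rV[R]_n -> R) (z : 'rV[R]_m * 'rV[R]_n) : Prop :=
  forall (x : 'rV[R]_m) (y : 'rV[R]_n),
    f z.1 y <= f z.1 z.2 <= f x z.2.

Definition simGDA_step (R : realType) (m n : nat)
    (f : 'rV[R]_m -> 'rV[R]_n -> R) (alpha beta : R)
    (z : 'rV[R]_m * 'rV[R]_n) : 'rV[R]_m * 'rV[R]_n :=
  (z.1 - alpha *: grad1 f z, z.2 + beta *: grad2 f z).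

Definition simGDA (R : realType) (m n : nat)
    (f : 'rV[R]_m -> 'rV[R]_n -> R) (alpha beta : R)
    (z0 : 'rV[R]_m * 'rV[R]_n) (k : nat) : 'rV[R]_m * 'rV[R]_n :=
  iter k (simGDA_step f alpha beta) z0.

(* On classF (with positive moduli) the maximum over y and the minimum over x
   are attained, so that sup and inf below are the max and the min. *)
Definition primal (R : realType) (m n : nat)
    (f : 'rV[R]_m -> 'rV[R]_n -> R) (x : 'rV[R]_m) : R :=
  sup (range (f x)).

Definition primal_min (R : realType) (m n : nat)
    (f : 'rV[R]_m -> 'rV[R]_n -> R) : R :=
  inf (range (primal f)).

Definition potential (R : realType) (m n : nat) (lambda : R)
    (f : 'rV[R]_m -> 'rV[R]_n -> R) (z : 'rV[R]_m * 'rV[R]_n) : R :=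
  lambda * (primal f z.1 - primal_min f) + (primal f z.1 - f z.1 z.2).

(* Main.v *)
Require Import Defs.
From mathcomp Require Import all_boot all_order all_algebra.
From mathcomp Require Import all_classical all_reals all_analysis.
From mathcomp Require Import ring lra.
Import Order.TTheory GRing.Theory Num.Theory numFieldNormedType.Exports.
Local Open Scope classical_set_scope.
Local Open Scope ring_scope.

(** A single quadratic f, independent of the step size ratio r, is slow in all
three regimes at once. It is a sum of functions of four coordinate pairs, each
of the form a/2 x^2 + b x y - d/2 y^2, on which simGDA acts separately:

- (a, b, d) = (L, 0, L) forbids large steps: the iterates decay only if
  alpha L < 2 and beta L < 2.
- (a, b, d) = (mu1, 0, mu2) makes small steps slow: the errors in x and y
  shrink by the factors 1 - alpha mu1 and 1 - beta mu2 per iteration, so K must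
  be at least of order log(1/eps) / min(alpha mu1, beta mu2).
- (a, b, d) = (mu1, B, mu2), with B = (1 - 1/c) L, occurs twice. The update is
  a linear map of the plane of determinant
  (1 - alpha mu1)(1 - beta mu2) + alpha beta B^2, whose last term is due to the
  coupling. Areas must shrink for all iterates to decay, so this determinant is
  below 1, which bounds alpha beta B^2 by alpha mu1 + beta mu2.

In the last item, a single starting point could lie on a contracting
eigenvector when the update has real eigenvalues. Two copies of the
pair, started at (1, 0) and (0, 1), exclude this without any discussion of
eigenvalues: the determinant formed by the two iterates is exactly the K-th
power of the determinant of the update (simGDA_quad_wronskian), and it is at
most the squared norm of the whole iterate (wronskian_le_sqnorm2).

Write s1 = alpha mu1, s2 = beta mu2 and A for a multiple of log(1/eps)
depending on c. The second item gives A <= s1 K and A <= s2 K. With r = beta /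
alpha, the bound beta L < 2 turns the first inequality into
K >= kappa1 r A / 2, and alpha L < 2 turns the second into
K >= kappa2 A / (2 r). The determinant condition reads
(B^2 / (mu1 mu2)) s1 s2 < s1 + s2, hence min(s1, s2) < 2 mu1 mu2 / B^2, which
is the bound of order kappa1 kappa2 (hard_fun_steps).

The inequality A <= s1 K needs care when s1 is not small, since 1 - s1 may
then vanish. In that case the first item takes over: |1 - s1| and |1 - alpha L|
cannot both be small because alpha L >= c s1 with c > 1 (ln_le_steps).

Finally, the potential dominates a positive multiple delta of the squared
distance to the saddle point (potential_quad_ge). As the threshold on eps may
depend on delta, either accuracy criterion yields |z_K|^2 <= eps once
eps < min(1, delta), and replacing eps^2 by eps costs only a factor 2 in the
logarithm. *)

Set Implicit Arguments.
Unset Strict Implicit.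
Unset Printing Implicit Defensive.

(** * Separable quadratic saddle functions *)

Definition quad (R : realType) (n : nat) (a b d : 'I_n -> R)
    (x y : 'rV[R]_n) : R :=
  \sum_i (a i / 2 * x 0 i ^+ 2 + b i * (x 0 i * y 0 i) - d i / 2 * y 0 i ^+ 2).

(** Exchanging the two players negates the coupling; this reduces concavity in y
to convexity in x. *)
Lemma quadN (R : realType) (n : nat) (a b d : 'I_n -> R) (x y : 'rV[R]_n) :
  - quad a b d x y = quad d (fun i => - b i) a y x.
Proof. by rewrite /quad -sumrN; apply: eq_bigr => i _; ring. Qed.

(** Partial derivatives of a quadratic are read off its expansion along a line,
without going through the rules of differential calculus. *)
Lemma derive_quadratic_line (R : realType) (n : nat) (g : 'rV[R]_n -> R)
    (x v : 'rV[R]_n) (A B : R) :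
  (forall h, g (h *: v + x) = g x + (h * A + h ^+ 2 * B)) -> 'D_v g x = A.
Proof.
move=> gE; apply: cvg_lim => //.
have lim_affine : A + h * B @[h --> (0 : R)^'] --> A.
  rewrite -[X in _ --> X]addr0 -[X in _ --> _ + X](mul0r B).
  apply: cvgD; first exact: cvg_cst.
  apply: cvgM; last exact: cvg_cst.
  exact/cvg_within.
apply: cvg_trans lim_affine; apply: near_eq_cvg.
near=> h; have h0 : h != 0 by near: h; exact: nbhs_dnbhs_neq.
by rewrite /= gE /GRing.scale/=; field.
Unshelve. all: by end_near. Qed.

Lemma grad1_quad (R : realType) (n : nat) (a b d : 'I_n -> R) z :
  grad1 (quad a b d) z = \row_i (a i * z.1 0 i + b i * z.2 0 i).
Proof.
apply/rowP => i; rewrite !mxE.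
apply: (@derive_quadratic_line _ _ _ _ _ _ (a i / 2)) => h.
rewrite /quad (bigD1 i)//= [in RHS](bigD1 i)//= !mxE !eqxx.
under eq_bigr => j ji do rewrite !mxE eqxx (negbTE ji) /= mulr0 add0r.
rewrite mulr1; set T := (\sum_(_ | _) _); move: T => T.
by field.
Qed.

Lemma grad2_quad (R : realType) (n : nat) (a b d : 'I_n -> R) z :
  grad2 (quad a b d) z = \row_i (b i * z.1 0 i - d i * z.2 0 i).
Proof.
apply/rowP => i; rewrite !mxE.
apply: (@derive_quadratic_line _ _ _ _ _ _ (- d i / 2)) => h.
rewrite /quad (bigD1 i)//= [in RHS](bigD1 i)//= !mxE !eqxx.
under eq_bigr => j ji do rewrite !mxE eqxx (negbTE ji) /= mulr0 add0r.
rewrite mulr1; set T := (\sum_(_ | _) _); move: T => T.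
by field.
Qed.

(** The matrix with rows (a, b) and (b, -d) has operator norm at most
max(a, d) + b: a diagonal part plus b times an isometry. When a is the larger
diagonal entry, the difference of the two sides for L = a + b is displayed as a
sum of squares with nonnegative coefficients. *)
Lemma coord_grad_lipschitz (R : realType) (a b d L u v : R) :
  0 <= a -> 0 <= b -> 0 <= d -> a + b <= L -> d + b <= L ->
  (a * u + b * v) ^+ 2 + (b * u - d * v) ^+ 2 <= L ^+ 2 * (u ^+ 2 + v ^+ 2).
Proof.
wlog da : a d u v / d <= a => [H a0 b0 d0 abL dbL|a0 b0 d0 abL dbL].
  have [da|/ltW ad] := leP d a; first exact: H.
  (* a quarter turn in the (u, v) plane exchanges a and d *)
  have := H d a v (- u) ad d0 b0 a0 dbL abL.
  by congr (_ <= _); ring.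
have bound : (a + b) ^+ 2 * (u ^+ 2 + v ^+ 2) <= L ^+ 2 * (u ^+ 2 + v ^+ 2).
  by rewrite ler_wpM2r ?addr_ge0 ?sqr_ge0// ler_pXn2r// nnegrE; lra.
have uv : 0 <= b * (a - d) * (u - v) ^+ 2.
  by rewrite mulr_ge0 ?sqr_ge0 ?mulr_ge0 ?subr_ge0.
have u2 : 0 <= (a * b + b * d) * u ^+ 2 by rewrite mulr_ge0 ?sqr_ge0//; nra.
have v2 : 0 <= (a * b + b * d + (a - d) * (a + d)) * v ^+ 2.
  by rewrite mulr_ge0 ?sqr_ge0//; nra.
apply: le_trans bound; rewrite -subr_ge0.
have -> : (a + b) ^+ 2 * (u ^+ 2 + v ^+ 2) -
    ((a * u + b * v) ^+ 2 + (b * u - d * v) ^+ 2) =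
    b * (a - d) * (u - v) ^+ 2 + (a * b + b * d) * u ^+ 2 +
    (a * b + b * d + (a - d) * (a + d)) * v ^+ 2 by ring.
by rewrite !addr_ge0.
Qed.

Lemma sqnorm2E (R : realType) (n : nat) (z : 'rV[R]_n * 'rV[R]_n) :
  sqnorm2 z = \sum_i (z.1 0 i ^+ 2 + z.2 0 i ^+ 2).
Proof. by rewrite /sqnorm2 /sqnorm big_split. Qed.

Lemma differentiable_quad (R : realType) (n : nat) (a b d : 'I_n -> R) z :
  differentiable (fun w : 'rV[R]_n * 'rV[R]_n => quad a b d w.1 w.2) z.
Proof.
have d1 i : differentiable (fun w : 'rV[R]_n * 'rV[R]_n => w.1 0 i : R) z.
  apply: (@differentiable_comp _ _ _ _ fst (fun x : 'rV[R]_n => x 0 i : R)).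
    by apply: linear_differentiable => w; exact: cvg_fst.
  exact: differentiable_coord.
have d2 i : differentiable (fun w : 'rV[R]_n * 'rV[R]_n => w.2 0 i : R) z.
  apply: (@differentiable_comp _ _ _ _ snd (fun x : 'rV[R]_n => x 0 i : R)).
    by apply: linear_differentiable => w; exact: cvg_snd.
  exact: differentiable_coord.
have -> : (fun w : 'rV[R]_n * 'rV[R]_n => quad a b d w.1 w.2) =
  \sum_i (fun w : 'rV[R]_n * 'rV[R]_n =>
    a i / 2 * (w.1 0 i * w.1 0 i) + b i * (w.1 0 i * w.2 0 i)
    - d i / 2 * (w.2 0 i * w.2 0 i)).
  by apply/funext => w; rewrite fct_sumE.
apply: differentiable_sum => i.
by apply: differentiableB; [apply: differentiableD|];
  apply: differentiableM => //; apply: differentiableM.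
Qed.

Lemma smooth_quad (R : realType) (n : nat) (L : R) (a b d : 'I_n -> R) :
  0 <= L -> (forall i, [/\ 0 <= a i, 0 <= b i & 0 <= d i]) ->
  (forall i, a i + b i <= L /\ d i + b i <= L) ->
  smooth L (quad a b d).
Proof.
move=> L0 abd0 abdL; split=> [z|z w]; first exact: differentiable_quad.
rewrite -[X in X * _](ger0_norm L0) -sqrtr_sqr -sqrtrM ?sqr_ge0// ler_wsqrtr//.
rewrite !sqnorm2E mulr_sumr ler_sum// => i _.
have [ai bi di] := abd0 i; have [abL dbL] := abdL i.
rewrite !grad1_quad !grad2_quad !mxE.
have := coord_grad_lipschitz
  (z.1 0 i - w.1 0 i) (z.2 0 i - w.2 0 i) ai bi di abL dbL.
by congr (_ <= _); congr (_ ^+ 2 + _ ^+ 2); ring.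
Qed.

Lemma strongly_convex_quad (R : realType) (n : nat) (mu : R)
    (a b d : 'I_n -> R) (y : 'rV[R]_n) :
  (forall i, mu <= a i) -> strongly_convex mu (fun x => quad a b d x y).
Proof.
move=> mua x x' t /andP[t0 t1].
rewrite /quad /sqnorm !mulr_sumr -big_split/= -sumrB ler_sum// => i _.
rewrite !mxE.
(* the convexity gap of a / 2 * x ^+ 2 is exactly a / 2 * t * (1 - t) *
   (x - x') ^+ 2 *)
have h : 0 <= t * (1 - t) * (a i - mu) * (x 0 i - x' 0 i) ^+ 2.
  by rewrite mulr_ge0 ?sqr_ge0 ?mulr_ge0 ?subr_ge0.
rewrite -subr_ge0; move: h; nra.
Qed.

Lemma classF_quad (R : realType) (n : nat) (L mu1 mu2 : R)
    (a b d : 'I_n -> R) :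
  0 < L -> 0 < mu1 -> 0 < mu2 ->
  (forall i, [/\ mu1 <= a i, 0 <= b i & mu2 <= d i]) ->
  (forall i, a i + b i <= L /\ d i + b i <= L) ->
  classF L mu1 mu2 (quad a b d).
Proof.
move=> L0 m1 m2 abd abdL; split.
- apply: smooth_quad => //; first exact: ltW.
  by move=> i; have [ai bi di] := abd i; split=> //; lra.
- by move=> y; apply: strongly_convex_quad => i; have [] := abd i.
- move=> x; rewrite /strongly_concave.
  under eq_fun do rewrite quadN.
  by apply: strongly_convex_quad => i; have [] := abd i.
Qed.

(** * Saddle point and potential *)

Lemma quadx0 (R : realType) (n : nat) (a b d : 'I_n -> R) (x : 'rV[R]_n) :
  quad a b d x 0 = \sum_i a i / 2 * x 0 i ^+ 2.
Proof. by rewrite /quad; apply: eq_bigr => i _; rewrite mxE; ring. Qed.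

Lemma quad0y (R : realType) (n : nat) (a b d : 'I_n -> R) (y : 'rV[R]_n) :
  quad a b d 0 y = - \sum_i d i / 2 * y 0 i ^+ 2.
Proof. by rewrite /quad -sumrN; apply: eq_bigr => i _; rewrite mxE; ring. Qed.

Lemma diag_form_ge0 (R : realType) (n : nat) (a : 'I_n -> R) (x : 'rV[R]_n) :
  (forall i, 0 < a i) -> 0 <= \sum_i a i / 2 * x 0 i ^+ 2.
Proof.
move=> a0; apply: sumr_ge0 => i _.
by rewrite mulr_ge0 ?sqr_ge0// divr_ge0// ltW.
Qed.

Lemma diag_form_le0 (R : realType) (n : nat) (a : 'I_n -> R) (x : 'rV[R]_n) :
  (forall i, 0 < a i) -> \sum_i a i / 2 * x 0 i ^+ 2 <= 0 -> x = 0.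
Proof.
move=> a0 le0; have ge0 i : 0 <= a i / 2 * x 0 i ^+ 2.
  by rewrite mulr_ge0 ?sqr_ge0// divr_ge0// ltW.
have /eqP : \sum_i a i / 2 * x 0 i ^+ 2 = 0.
  by apply/eqP; rewrite eq_le le0 diag_form_ge0.
rewrite psumr_eq0// => /allP x0; apply/rowP => i; rewrite mxE.
have := x0 i (mem_index_enum i); rewrite implyTb mulf_eq0 sqrf_eq0.
have a2 : a i / 2 != 0 by rewrite gt_eqF// divr_gt0.
by rewrite (negbTE a2) => /eqP.
Qed.

(** Uniqueness: comparing a saddle point z with 0 gives f(z.1, 0) <= f(0, z.2),
where the left side is nonnegative and the right side nonpositive, so both
forms vanish. *)
Lemma saddle_quad (R : realType) (n : nat) (a b d : 'I_n -> R) :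
  (forall i, 0 < a i) -> (forall i, 0 < d i) ->
  saddle_point (quad a b d) 0 /\
  (forall z, saddle_point (quad a b d) z -> z = 0).
Proof.
move=> a0 d0; split=> [x y|[zx zy] sz] /=.
  rewrite !quadx0 quad0y.
  under [X in _ <= X <= _]eq_bigr do rewrite mxE expr0n mulr0.
  by rewrite sumr_const mul0rn oppr_le0 !diag_form_ge0.
have := sz 0 0; rewrite /= quadx0 quad0y => /andP[h1 h2].
have x0 := diag_form_ge0 zx a0; have y0 := diag_form_ge0 zy d0.
by congr pair; [apply: (diag_form_le0 a0)|apply: (diag_form_le0 d0)]; lra.
Qed.

Lemma sup_range_max (R : realType) (T : Type) (g : T -> R) (t : T) :
  (forall u, g u <= g t) -> sup (range g) = g t.
Proof.
move=> gt; apply/eqP; rewrite eq_le; apply/andP; split.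
  by apply: ge_sup; [exists (g t), t|move=> _ [u _ <-]].
by apply: ub_le_sup; [exists (g t) => _ [u _ <-]|exists t].
Qed.

Lemma primal_quad (R : realType) (n : nat) (a b d : 'I_n -> R)
    (x : 'rV[R]_n) : (forall i, 0 < d i) ->
  primal (quad a b d) x = \sum_i (a i + b i ^+ 2 / d i) / 2 * x 0 i ^+ 2.
Proof.
move=> d0; have dn i : d i != 0 by rewrite gt_eqF.
pose y := \row_i (b i / d i * x 0 i).
rewrite /primal (@sup_range_max _ _ _ y) => [|y'].
  by apply: eq_bigr => i _; rewrite mxE; field.
apply: ler_sum => i _; rewrite mxE -subr_ge0.
suff -> : forall u v : R, a i / 2 * u ^+ 2 + b i * (u * (b i / d i * u))
    - d i / 2 * (b i / d i * u) ^+ 2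
    - (a i / 2 * u ^+ 2 + b i * (u * v) - d i / 2 * v ^+ 2) =
    d i / 2 * (v - b i / d i * u) ^+ 2.
  by rewrite mulr_ge0 ?sqr_ge0// divr_ge0// ltW.
by move=> u v; field.
Qed.

Lemma primal_min_quad (R : realType) (n : nat) (a b d : 'I_n -> R) :
  (forall i, 0 < a i) -> (forall i, 0 < d i) ->
  primal_min (quad a b d) = 0.
Proof.
move=> a0 d0; rewrite /primal_min /inf.
have -> : [set - x | x in range (primal (quad a b d))] =
          range (fun x => - primal (quad a b d) x).
  by rewrite image_comp.
have e0 i : 0 < a i + b i ^+ 2 / d i.
  by rewrite ltr_pwDl// divr_ge0 ?sqr_ge0// ltW.
have p0 : primal (quad a b d) 0 = 0.
  by rewrite primal_quad// big1// => i _; rewrite mxE expr0n mulr0.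
rewrite (@sup_range_max _ _ _ 0) p0 ?oppr0// => x.
by rewrite oppr_le0 primal_quad// diag_form_ge0.
Qed.

(** A small potential forces a small distance to the saddle point: its first
term controls x, its second term controls the distance from y to the best
response (b / d) x, and together they control y. *)
Lemma potential_quad_ge (R : realType) (n : nat) (L mu1 mu2 lambda : R)
    (a b d : 'I_n -> R) :
  0 < mu1 -> 0 < mu2 -> 0 < lambda ->
  (forall i, [/\ mu1 <= a i, 0 <= b i <= L & mu2 <= d i]) ->
  exists2 delta : R, 0 < delta &
    forall z, delta * sqnorm2 z <= potential lambda (quad a b d) z.
Proof.
move=> m1 m2 l0 abd.
have a0 i : 0 < a i by have [h _ _] := abd i; exact: lt_le_trans h.
have d0 i : 0 < d i by have [_ _ h] := abd i; exact: lt_le_trans h.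
(* from y^2 <= 2 (y - p x)^2 + 2 p^2 x^2, where p = b / d <= L / mu2 *)
pose M := 1 + 2 * (L / mu2) ^+ 2.
have M0 : 0 < M by rewrite ltr_pwDl// mulr_ge0 ?sqr_ge0.
pose delta := Num.min (lambda * mu1 / 2 / M) (mu2 / 4).
have delta0 : 0 < delta by rewrite lt_min !divr_gt0// mulr_gt0.
have dM : delta * M <= lambda * mu1 / 2 by rewrite -ler_pdivlMr// ge_min lexx.
have dm : delta * 4 <= mu2 by rewrite -ler_pdivlMr// ge_min lexx orbT.
exists delta => // z.
rewrite /potential primal_min_quad// subr0 primal_quad// sqnorm2E.
rewrite -sumrB !mulr_sumr -big_split/= ler_sum// => i _.
have [ai /andP[bi0 biL] di] := abd i.
have dn : d i != 0 by rewrite gt_eqF.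
move: (z.1 0 i) (z.2 0 i) => x y; pose p := b i / d i.
have p0 : 0 <= p by rewrite divr_ge0// ltW.
have pL : p <= L / mu2.
  by rewrite ler_pM ?invr_ge0 ?(ltW (d0 i))// lef_pV2 ?posrE.
have p2 : p ^+ 2 <= (L / mu2) ^+ 2 by rewrite ler_pXn2r// nnegrE// (le_trans p0).
have -> : lambda * ((a i + b i ^+ 2 / d i) / 2 * x ^+ 2) +
    ((a i + b i ^+ 2 / d i) / 2 * x ^+ 2 -
     (a i / 2 * x ^+ 2 + b i * (x * y) - d i / 2 * y ^+ 2)) =
   lambda * (a i / 2 * x ^+ 2) + lambda * (b i ^+ 2 / d i / 2 * x ^+ 2) +
   d i / 2 * (y - p * x) ^+ 2 by rewrite /p; field.
have h1 : 0 <= lambda * (b i ^+ 2 / d i / 2 * x ^+ 2).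
  by rewrite mulr_ge0 ?(ltW l0)// mulr_ge0 ?sqr_ge0// !divr_ge0 ?sqr_ge0// ltW.
have h2 : lambda * mu1 / 2 * x ^+ 2 <= lambda * (a i / 2 * x ^+ 2).
  by rewrite mulrA ler_wpM2r ?sqr_ge0// -mulrA ler_wpM2l ?(ltW l0)//; lra.
have h3 : delta * 2 * (y - p * x) ^+ 2 <= d i / 2 * (y - p * x) ^+ 2.
  by rewrite ler_wpM2r ?sqr_ge0//; lra.
have h4 : delta * M * x ^+ 2 <= lambda * mu1 / 2 * x ^+ 2.
  by rewrite ler_wpM2r ?sqr_ge0.
have h5 : delta * (1 + 2 * p ^+ 2) * x ^+ 2 <= delta * M * x ^+ 2.
  by rewrite ler_wpM2r ?sqr_ge0// ler_wpM2l ?(ltW delta0)// lerD2l ler_wpM2l.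
have h6 : 0 <= delta * (y - 2 * (p * x)) ^+ 2.
  by rewrite mulr_ge0 ?sqr_ge0// ltW.
have h7 : delta * (y - 2 * (p * x)) ^+ 2 = delta * 2 * (y - p * x) ^+ 2 +
  delta * (1 + 2 * p ^+ 2) * x ^+ 2 - delta * (x ^+ 2 + y ^+ 2) by ring.
lra.
Qed.

(** * Iterates of simGDA on a separable quadratic *)

Lemma simGDA_quad_decoupled (R : realType) (n : nat) (a b d : 'I_n -> R)
    (alpha beta : R) z0 K (i : 'I_n) : b i = 0 ->
  let z := simGDA (quad a b d) alpha beta z0 K in
  z.1 0 i = (1 - alpha * a i) ^+ K * z0.1 0 i /\
  z.2 0 i = (1 - beta * d i) ^+ K * z0.2 0 i.
Proof.
move=> bi /=; elim: K => [|K [IH1 IH2]]; first by rewrite !expr0 !mul1r.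
rewrite /simGDA iterS -/(simGDA _ _ _ _ _) /simGDA_step/=.
by rewrite grad1_quad grad2_quad !mxE IH1 IH2 bi !exprS; split; ring.
Qed.

(** Two coordinate pairs with the same coefficients undergo the same linear map
of the plane, so the determinant of the two iterates is multiplied at each step
by the determinant of that map. *)
Lemma simGDA_quad_wronskian (R : realType) (n : nat) (a b d : 'I_n -> R)
    (alpha beta : R) z0 K (i j : 'I_n) :
  a i = a j -> b i = b j -> d i = d j ->
  let w (z : 'rV[R]_n * 'rV[R]_n) := z.1 0 i * z.2 0 j - z.2 0 i * z.1 0 j in
  w (simGDA (quad a b d) alpha beta z0 K) =
  ((1 - alpha * a i) * (1 - beta * d i) + alpha * beta * b i ^+ 2) ^+ K * w z0.
Proof.
move=> aij bij dij w; elim: K => [|K IH]; first by rewrite expr0 mul1r.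
rewrite exprS -mulrA -IH /simGDA iterS -/(simGDA _ _ _ _ _).
move: (simGDA _ _ _ _ _) => z.
rewrite /w /simGDA_step/= grad1_quad grad2_quad !mxE -aij -bij -dij.
ring.
Qed.

Lemma coord_le_sqnorm2 (R : realType) (n : nat) (z : 'rV[R]_n * 'rV[R]_n)
    (i : 'I_n) : z.1 0 i ^+ 2 + z.2 0 i ^+ 2 <= sqnorm2 z.
Proof.
rewrite sqnorm2E (bigD1 i)//= lerDl.
by apply: sumr_ge0 => j _; rewrite addr_ge0 ?sqr_ge0.
Qed.

(** From 2 u v <= u^2 + v^2, applied to each of the two products. *)
Lemma wronskian_le_sqnorm2 (R : realType) (n : nat)
    (z : 'rV[R]_n * 'rV[R]_n) (i j : 'I_n) : i != j ->
  z.1 0 i * z.2 0 j - z.2 0 i * z.1 0 j <= sqnorm2 z.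
Proof.
move=> ij; rewrite sqnorm2E (bigD1 i)//= (bigD1 j) 1?eq_sym//=.
set T := \sum_(_ | _) _; have T0 : 0 <= T.
  by apply: sumr_ge0 => k _; rewrite addr_ge0 ?sqr_ge0.
have := sqr_ge0 (z.1 0 i - z.2 0 j); have := sqr_ge0 (z.2 0 i + z.1 0 j).
have := sqr_ge0 (z.1 0 i); have := sqr_ge0 (z.2 0 i).
have := sqr_ge0 (z.1 0 j); have := sqr_ge0 (z.2 0 j).
nra.
Qed.

(** * Step counts from contraction factors *)

Lemma sqr_lt1_of_expr (R : realType) (q : R) (K : nat) :
  (q ^+ K) ^+ 2 < 1 -> q ^+ 2 < 1.
Proof. by rewrite exprAC; apply: contraTT; rewrite -!leNgt; exact: exprn_ege1. Qed.

(** With M = (c + 1) / (c - 1), one of |1 - s| and |1 - S| is at least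
1 / (1 + M s), hence at least exp(- M s). Otherwise the first would give
M s > M - 1 and the second (c s - 1)(1 + M s) < 1, which are incompatible by
the choice of M. Thus K steps contract by at most exp(- M s K); the
hypothesis on S matters when s is near 1, where 1 - s alone gives nothing. *)
Lemma ln_le_steps (R : realType) (c s S e : R) (K : nat) :
  1 < c -> 0 < s -> c * s <= S -> 0 < e ->
  ((1 - s) ^+ K) ^+ 2 <= e -> ((1 - S) ^+ K) ^+ 2 <= e ->
  (c - 1) / (2 * (c + 1)) * ln (1 / e) <= s * K%:R.
Proof.
move=> c1 s0 csS e0 hs hS.
pose M := (c + 1) / (c - 1).
have c10 : 0 < c - 1 by lra.
have M0 : 0 < M by rewrite divr_gt0//; lra.
have M1 : M * (c - 1) = c + 1 by rewrite /M mulfVK// gt_eqF.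
pose q := 1 + M * s.
have Ms0 : 0 < M * s by rewrite mulr_gt0.
have q0 : 0 < q by rewrite /q; lra.
have [t te tq] : exists2 t, (t ^+ K) ^+ 2 <= e & 1 <= (t * q) ^+ 2.
  have [h|h] := leP 1 ((1 - s) * q); first by exists (1 - s); rewrite ?exprn_ege1.
  exists (1 - S) => //; rewrite -[_ ^+ 2]sqrrN -mulNr opprB exprn_ege1//.
  have sM : M - 1 < M * s by move: h; rewrite /q; nra.
  have h1 : c * (M - 1) < M * (c * s) by nra.
  have h2 : 1 < M * (c * s - 1) by lra.
  have cs1 : 0 < c * s - 1 by rewrite -(pmulr_rgt0 _ M0); lra.
  have h3 : M * (c * s - 1) <= (c * s - 1) * q.
    by rewrite mulrC ler_wpM2l ?(ltW cs1)// /q; lra.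
  have h4 : (c * s - 1) * q <= (S - 1) * q by rewrite ler_wpM2r ?(ltW q0)//; lra.
  lra.
have qexp : q <= expR (M * s) by exact: expR_ge1Dx.
have h : 1 / e <= (expR (M * s) ^+ K) ^+ 2.
  rewrite ler_pdivrMr// mulrC; apply: (@le_trans _ _ (((t * q) ^+ 2) ^+ K)).
    exact: exprn_ege1.
  rewrite exprAC !exprMn ler_pM ?sqr_ge0//.
  by rewrite !lerXn2r ?nnegrE ?exprn_ge0 ?expR_ge0 ?(ltW q0).
move: h; rewrite -ler_ln ?posrE ?exprn_gt0 ?expR_gt0 ?divr_gt0//.
rewrite -!expRM_natl expRK => hl.
have -> : (c - 1) / (2 * (c + 1)) = (2 * M)^-1.
  by rewrite /M; field; rewrite !gt_eqF//; lra.
have M20 : 0 < 2 * M by lra.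
rewrite mulrC ler_pdivrMr//.
suff -> : s * K%:R * (2 * M) = 2 * (K%:R * (M * s)) by [].
ring.
Qed.

(** The harmonic-type bound min(s1, s2) < 2 / Q, in a form free of division. *)
Lemma product_lt_sum_steps (R : realType) (s1 s2 Q T K : R) :
  0 < s1 -> 0 < s2 -> 0 <= Q -> 0 <= K -> T <= s1 * K -> T <= s2 * K ->
  Q * (s1 * s2) < s1 + s2 -> Q * T <= 2 * K.
Proof.
wlog s12 : s1 s2 / s1 <= s2 => [H|].
  have [le12|/ltW le21] := leP s1 s2; first exact: H.
  by move=> *; apply: (H s2 s1) => //; rewrite 1?[s2 * s1]mulrC 1?[s2 + s1]addrC.
move=> s1p s2p Q0 K0 T1 T2 Qs.
have Qs1 : Q * s1 < 2 by rewrite -(ltr_pM2r s2p); lra.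
have h1 : Q * T <= Q * (s1 * K) by rewrite ler_wpM2l.
have h2 : Q * s1 * K <= 2 * K by rewrite ler_wpM2r// ltW.
lra.
Qed.

(** * The hard instance *)

Definition hard_curvature (R : realType) (L mu : R) (i : 'I_4) : R :=
  if (i == 0 :> nat)%N then L else mu.

(** The coupled coordinates are 2 and 3: two copies of the same pair. *)
Definition hard_coupling (R : realType) (B : R) (i : 'I_4) : R :=
  if (2 <= i)%N then B else 0.

Definition hard_fun (R : realType) (L mu1 mu2 B : R) :
    'rV[R]_4 -> 'rV[R]_4 -> R :=
  quad (hard_curvature L mu1) (hard_coupling B) (hard_curvature L mu2).

(** Every entry is 1, except that the two coupled pairs start at the two basis
vectors (1, 0) and (0, 1) of the plane, where their determinant is 1. *)
Definition hard_start (R : realType) : 'rV[R]_4 * 'rV[R]_4 :=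
  (\row_i (i != 3 :> nat)%:R, \row_i (i != 2 :> nat)%:R).

(** The moduli are at most L / c, which leaves (1 - 1/c) L for the coupling in the
bound on the operator norm by the larger modulus plus the coupling. *)
Lemma hard_fun_coeffs (R : realType) (c L mu1 mu2 : R) :
  1 < c -> 0 < L -> 0 < mu1 -> 0 < mu2 -> c * mu1 <= L -> c * mu2 <= L ->
  let a := hard_curvature L mu1 in
  let b := hard_coupling ((1 - c^-1) * L) in
  let d := hard_curvature L mu2 in
  forall i, [/\ mu1 <= a i, 0 <= b i & mu2 <= d i] /\
            (a i + b i <= L /\ d i + b i <= L).
Proof.
move=> c1 L0 m1 m2 cm1 cm2 a b d i.
have c0 : 0 < c by lra.
have h1 : mu1 <= c^-1 * L by rewrite ler_pdivlMl.
have h2 : mu2 <= c^-1 * L by rewrite ler_pdivlMl.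
have ci1 : c^-1 * L < L by rewrite gtr_pMl// invf_lt1.
rewrite /a /b /d /hard_curvature /hard_coupling.
case: (posnP i) => [->|i0] /=; first by do !split; lra.
case: ifP => _; do !split; lra.
Qed.

(** All three lower bounds hold for every ratio r. They come respectively from
beta L < 2, from the determinant of the coupled pairs being below 1, and from
alpha L < 2, each combined with the slow decay of the pair with moduli
mu1, mu2. *)
Lemma hard_fun_steps (R : realType) (c L mu1 mu2 r beta e : R) (K : nat) :
  1 < c -> 0 < L -> 0 < mu1 -> 0 < mu2 -> c * mu1 <= L -> c * mu2 <= L ->
  0 < r -> 0 < beta -> 0 < e < 1 ->
  let g := 1 - c^-1 in
  let A := (c - 1) / (2 * (c + 1)) * ln (1 / e) in
  sqnorm2 (simGDA (hard_fun L mu1 mu2 (g * L)) (beta / r) beta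
             (hard_start R) K) <= e ->
  [/\ L / mu1 * r * A <= 2 * K%:R,
      L / mu1 * (L / mu2) * g ^+ 2 * A <= 2 * K%:R &
      L / mu2 / r * A <= 2 * K%:R].
Proof.
move=> c1 L0 m1 m2 cm1 cm2 r0 b0 /andP[e0 e1] g A.
set z := simGDA _ _ _ _ _; set alpha := beta / r => ze.
have al0 : 0 < alpha by rewrite divr_gt0.
have rn : r != 0 by rewrite gt_eqF.
have m1n : mu1 != 0 by rewrite gt_eqF.
have m2n : mu2 != 0 by rewrite gt_eqF.
have K0 : 0 <= K%:R :> R by rewrite ler0n.
pose i0 := @Ordinal 4 0 isT; pose i1 := @Ordinal 4 1 isT.
pose i2 := @Ordinal 4 2 isT; pose i3 := @Ordinal 4 3 isT.
have dec (i : 'I_4) : (i < 2)%N ->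
    ((1 - alpha * hard_curvature L mu1 i) ^+ K) ^+ 2 <= e /\
    ((1 - beta * hard_curvature L mu2 i) ^+ K) ^+ 2 <= e.
  move=> i2'.
  have bi : hard_coupling (g * L) i = 0 by rewrite /hard_coupling leqNgt i2'.
  have := coord_le_sqnorm2 z i.
  have [-> ->] := simGDA_quad_decoupled (hard_curvature L mu1)
    (hard_curvature L mu2) alpha beta (hard_start R) K bi.
  have [n3 n2] : (i != 3 :> nat) /\ (i != 2 :> nat).
    by rewrite !neq_ltn (ltn_trans i2' ) // i2'.
  rewrite !mxE n3 n2 !mulr1 => h.
  have := sqr_ge0 ((1 - alpha * hard_curvature L mu1 i) ^+ K).
  have := sqr_ge0 ((1 - beta * hard_curvature L mu2 i) ^+ K).
  by split; lra.
have [xL yL] := dec i0 isT; have [xm ym] := dec i1 isT.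
rewrite /hard_curvature/= in xL yL xm ym.
have s1A : A <= alpha * mu1 * K%:R.
  apply: (@ln_le_steps _ _ _ (alpha * L)) => //; first by rewrite mulr_gt0.
  by rewrite mulrCA ler_wpM2l ?(ltW al0).
have s2A : A <= beta * mu2 * K%:R.
  apply: (@ln_le_steps _ _ _ (beta * L)) => //; first by rewrite mulr_gt0.
  by rewrite mulrCA ler_wpM2l ?(ltW b0).
have stable s : ((1 - s) ^+ K) ^+ 2 <= e -> s < 2.
  move=> /le_lt_trans/(_ e1)/sqr_lt1_of_expr; rewrite !ltNge; apply: contraNN.
  by move=> s2; rewrite -sqrrN opprB exprn_ege1//; lra.
have aL := stable _ xL; have bL := stable _ yL.
have det :
    (1 - alpha * mu1) * (1 - beta * mu2) + alpha * beta * (g * L) ^+ 2 < 1.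
  have i23 : i2 != i3 by [].
  have := wronskian_le_sqnorm2 z i23.
  rewrite [X in X <= _]simGDA_quad_wronskian// !mxE/= mulr1 mulr0 subr0 mulr1.
  move=> /le_trans/(_ ze)/le_lt_trans/(_ e1).
  by rewrite !ltNge; apply: contraNN; exact: exprn_ege1.
have k1r : 0 < L / mu1 * r by rewrite mulr_gt0// divr_gt0.
have k2r : 0 < L / mu2 / r by rewrite !divr_gt0.
split.
- have h : alpha * mu1 * K%:R <= 2 / (L / mu1 * r) * K%:R.
    rewrite ler_wpM2r// ler_pdivlMr//.
    have -> : alpha * mu1 * (L / mu1 * r) = beta * L.
      by rewrite /alpha; field; rewrite rn m1n.
    exact: ltW.
  have := le_trans s1A h; rewrite mulrAC ler_pdivlMr//.
  by rewrite mulrC.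
- have s1p : 0 < alpha * mu1 by rewrite mulr_gt0.
  have s2p : 0 < beta * mu2 by rewrite mulr_gt0.
  have Q0 : 0 <= L / mu1 * (L / mu2) * g ^+ 2.
    by rewrite mulr_ge0 ?sqr_ge0// ltW// mulr_gt0// divr_gt0.
  apply: (product_lt_sum_steps s1p s2p Q0 K0) => //.
  have -> : L / mu1 * (L / mu2) * g ^+ 2 * (alpha * mu1 * (beta * mu2)) =
    alpha * beta * (g * L) ^+ 2 by field; rewrite m1n m2n.
  have : 0 < alpha * mu1 * (beta * mu2) by rewrite mulr_gt0.
  by move: det; lra.
- have h : beta * mu2 * K%:R <= 2 / (L / mu2 / r) * K%:R.
    rewrite ler_wpM2r// ler_pdivlMr//.
    have -> : beta * mu2 * (L / mu2 / r) = alpha * L.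
      by rewrite /alpha; field; rewrite rn m2n.
    exact: ltW.
  have := le_trans s2A h; rewrite mulrAC ler_pdivlMr//.
  by rewrite mulrC.
Qed.

Theorem theorem3 (R : realType) (c : R) (hc : 1 < c) :
  exists C : R, 0 < C /\
  forall L mu1 mu2 : R, 0 < L -> 0 < mu1 -> 0 < mu2 ->
  let kappa1 := L / mu1 in
  let kappa2 := L / mu2 in
  c <= kappa1 -> c <= kappa2 ->
  forall r : R, 0 < r ->
  exists (dx dy : nat) (f : 'rV[R]_dx -> 'rV[R]_dy -> R)
         (zs z0 : 'rV[R]_dx * 'rV[R]_dy),
    [/\ (0 < dx)%N,
        (0 < dy)%N,
        classF L mu1 mu2 f,
        saddle_point f zs /\ (forall z, saddle_point f z -> z = zs) &
        forall lambda : R, 0 < lambda ->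
        exists eps0 : R, 0 < eps0 /\
        forall eps : R, 0 < eps -> eps < eps0 ->
        forall (beta : R) (K : nat), 0 < beta ->
        let zK := simGDA f (beta / r) beta z0 K in
        sqnorm2 (zK - zs) <= eps ^+ 2 \/ potential lambda f zK <= eps ^+ 2 ->
        [/\ kappa2 / c <= r ->
              C * (kappa1 * r * ln (1 / eps)) <= K%:R,
            c / kappa1 <= r <= kappa2 / c ->
              C * (kappa1 * kappa2 * ln (1 / eps)) <= K%:R &
            r <= c / kappa1 ->
              C * (kappa2 / r * ln (1 / eps)) <= K%:R]].
Proof.
pose g := 1 - c^-1; pose A := (c - 1) / (2 * (c + 1)).
have c0 : 0 < c by lra.
have ci : 0 < c^-1 < 1 by rewrite invr_gt0 invf_lt1// c0.
have g0 : 0 < g by rewrite /g; lra.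
have g1 : g ^+ 2 <= 1 by rewrite expr_le1 ?(ltW g0)// /g; lra.
have A0 : 0 < A by rewrite divr_gt0//; lra.
exists (A * g ^+ 2 / 2); split; first by rewrite divr_gt0// mulr_gt0// exprn_gt0.
move=> L mu1 mu2 L0 m1 m2 kappa1 kappa2.
rewrite !ler_pdivlMr// => cm1 cm2 r r0.
have coeffs := hard_fun_coeffs hc L0 m1 m2 cm1 cm2.
exists 4%N, 4%N, (hard_fun L mu1 mu2 (g * L)), 0, (hard_start R); split => //.
- by apply: classF_quad => // i; have [] := coeffs i.
- by apply: saddle_quad => i; have [[? ? ?] _] := coeffs i; lra.
move=> lambda l0.
have [|delta delta0 potential_ge] := @potential_quad_ge _ _ L _ _ _
    (hard_curvature L mu1) (hard_coupling (g * L)) (hard_curvature L mu2)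
    m1 m2 l0.
  by move=> i; have [[? ? ?] [? ?]] := coeffs i; split=> //; lra.
exists (Num.min 1 delta); split; first by rewrite lt_min ltr01.
move=> eps e0; rewrite lt_min => /andP[e1 ed] beta K b0 zK close.
have zKe : sqnorm2 zK <= eps.
  case: close => [|h].
    by rewrite subr0 => /le_trans; apply; rewrite expr2 ger_pMl// ltW.
  rewrite -(ler_pM2l delta0) (le_trans (potential_ge _))// (le_trans h)//.
  by rewrite expr2 ler_wpM2r ?ltW.
have l1 : 0 < ln (1 / eps) by rewrite ln_gt0// ltr_pdivlMr// mul1r.
have e01 : 0 < eps < 1 by rewrite e0.
have [] := hard_fun_steps hc L0 m1 m2 cm1 cm2 r0 b0 e01 zKe.
rewrite -/g -/A -/kappa1 -/kappa2 => h1 h2 h3.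
have k1 : 0 < kappa1 by rewrite divr_gt0.
have k2 : 0 < kappa2 by rewrite divr_gt0.
(* g <= 1, so the constant of the coupled regime also serves the other two *)
have shrink Q : 0 < Q -> Q * (A * ln (1 / eps)) <= 2 * K%:R ->
    A * g ^+ 2 / 2 * (Q * ln (1 / eps)) <= K%:R.
  move=> Q0 hQ.
  have : g ^+ 2 * (Q * (A * ln (1 / eps))) <= 1 * (Q * (A * ln (1 / eps))).
    by rewrite ler_wpM2r// ltW// mulr_gt0// mulr_gt0.
  lra.
split=> _.
- by apply: shrink => //; rewrite mulr_gt0.
- lra.
- by apply: shrink => //; rewrite divr_gt0.
Qed.
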